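(* Let $Q$ be a convex subset of a finite-dimensional real vector space $E$, let $f$ be the objective of $\min_{x\in Q} f(x)$, and let $x_*\in Q$ be a minimizer. Let $L,\mu,m\ge 0$, let $\{\delta_k\}_{k\ge0}$, $\{\widetilde\delta_k\}_{k\ge 0}$ be sequences of nonnegative numbers, and assume that for every $k\ge 0$ the pair $(f_{\delta_k}(y),\psi_{\delta_k}(x,y))$ is a $(\delta_k,L,\mu,m,\phi)$-model of $f$ at every point $y$ (definition in the context). Assume also that there is a constant $G\ge 1$ such that for all $x,y,u,u_+\in \mathrm{ri}\,\mathrm{dom}\,\phi$ with $x-y=\tau(u_+-u)$ for some $\tau\in[0,1]$ one has $$D_\phi[y](x)\le G\tau^2 D_\phi[u](u_+).$$ Let $x_k,u_k,A_k$ be generated by the accelerated gradient method described in the context. Then after $N\ge 1$ iterations $$f(x_N)-f(x_* )\le \frac{D_\phi[u_0](x_* )}{A_N}+\frac{2\sum_{k=0}^{N-1}A_{k+1}\delta_k}{A_N}+\frac{\sum_{k=0}^{N-1}\widetilde\delta_k}{A_N},$$ $$D_\phi[u_N](x_* )\le \frac{D_\phi[u_0](x_* )}{1+A_N\mu+A_Nm}+\frac{2\sum_{k=0}^{N-1}A_{k+1}\delta_k}{1+A_N\mu+A_Nm}+\frac{\sum_{k=0}^{N-1}\widetilde\delta_k}{1+A_N\mu+A_Nm}.$$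
   Context: **Bregman divergence.** $\phi$ is a convex function on $Q$, continuously differentiable on the relative interior $\mathrm{ri}\,Q$, and $D_\phi[y](x)=\phi(x)-\phi(y)-\langle\nabla\phi(y),x-y\rangle$ for $x\in Q$, $y\in \mathrm{ri}\,Q$. It is implicitly understood that the points generated by the algorithm lie where the Bregman divergences below are defined and where the displayed assumption with constant $G$ is applicable. **Inexact model.** For $\delta,L,\mu,m\ge0$, a pair $(f_\delta(y),\psi_\delta(x,y))$ is a $(\delta,L,\mu,m,\phi)$-model of $f$ at $y$ iff for all $x\in Q$ $$\mu D_\phi[y](x)\le f(x)-\bigl(f_\delta(y)+\psi_\delta(x,y)\bigr)\le L D_\phi[y](x)+\delta,$$ $\psi_\delta(x,y)$ is convex in $x$, $\psi_\delta(x,x)=0$ for all $x\in Q$, and, writing $\psi(x)=\psi_\delta(x,y)$ for fixed $y$, $$\psi(x)\ge\psi(z)+\langle g,x-z\rangle+mD_\phi[z](x)\quad\forall x,z\in Q,\ \forall g\in\partial\psi(z).$$ **Inexact projection.** For convex $\Psi$ and $\widetilde\delta\ge0$, $\arg\min_{x\in Q}^{\widetilde\delta}\Psi(x)$ denotes some point $\widetilde x\in Q$ for which there is $h\in\partial\Psi(\widetilde x)$ with $\langle h,x-\widetilde x\rangle\ge-\widetilde\delta$ for all $x\in Q$ (such points are assumed available). **Algorithm (accelerated gradient method with $(\delta,L,\mu,m,\phi)$-model).** Input: starting point $x_0\in Q$, $\mu,m\ge0$, $\{\delta_k\},\{\widetilde\delta_k\}$, and $M_0>0$. Set $y_0=u_0=x_0$,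 $\alpha_0=A_0=0$. For $k=0,1,2,\dots$: find the smallest integer $i_k\ge0$ such that $$f_{\delta_k}(x_{k+1})\le f_{\delta_k}(y_{k+1})+\psi_{\delta_k}(x_{k+1},y_{k+1})+\frac{M_{k+1}\alpha_{k+1}^2}{A_{k+1}^2}D_\phi[u_k](u_{k+1})+\delta_k,$$ where $M_{k+1}=2^{i_k-1}M_k$; $\alpha_{k+1}$ is the largest root of $A_{k+1}(1+A_k\mu+A_km)=M_{k+1}\alpha_{k+1}^2$ with $A_{k+1}=A_k+\alpha_{k+1}$; and $$y_{k+1}=\frac{\alpha_{k+1}u_k+A_kx_k}{A_{k+1}},\qquad u_{k+1}={\arg\min_{x\in Q}}^{\widetilde\delta_k}\Phi_{k+1}(x),\qquad x_{k+1}=\frac{\alpha_{k+1}u_{k+1}+A_kx_k}{A_{k+1}},$$ $$\Phi_{k+1}(x)=\alpha_{k+1}\psi_{\delta_k}(x,y_{k+1})+(1+A_k(\mu+m))D_\phi[u_k](x)+\alpha_{k+1}\mu D_\phi[y_{k+1}](x).$$ *)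

(* Defs.v *)
From mathcomp Require Import all_boot all_order all_algebra.
From mathcomp Require Import all_classical all_reals all_analysis.

Set Implicit Arguments.
Unset Strict Implicit.
Unset Printing Implicit Defensive.

Import Order.TTheory GRing.Theory Num.Theory.
Import numFieldNormedType.Exports.

Local Open Scope classical_set_scope.
Local Open Scope ring_scope.

(* A finite-dimensional real vector space is represented by a normed module    *)
(* with a finite generating family; the norm is arbitrary and only serves to   *)
(* carry the canonical topology. The dual space is {linear E -> R^o}: in       *)
(* finite dimension every linear form is continuous.                           *)
Definition finite_dimensional (R : realType) (E : normedModType R) : Prop :=
  exists (n : nat) (b : 'I_n -> E),
    forall v, exists c : 'I_n -> R, v = \sum_(i < n) c i *: b i.

Section ConvexAnalysis.
Context {R : realType} {E : normedModType R}.
Implicit Types (Q : set E) (x y z : E).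

Definition affine_hull Q : set E :=
  [set z | exists (n : nat) (c : 'I_n -> R) (p : 'I_n -> E),
     [/\ forall i, Q (p i), \sum_(i < n) c i = 1
       & z = \sum_(i < n) c i *: p i]].

Definition relint Q : set E :=
  [set x | Q x /\ \forall z \near x, affine_hull Q z -> Q z].

(* Functions "on Q" are total functions whose values outside Q are never used; *)
(* in particular, subgradients are those of the function on Q.                 *)
Definition subdifferential Q (Psi : E -> R) z : set {linear E -> R^o} :=
  [set g | Q z /\ forall x, Q x -> Psi z + g (x - z) <= Psi x].

(* dphi y plays the role of the gradient at y, as an element of the dual. When *)
(* Q has empty interior it is only determined on the direction space of Q; any *)
(* choice gives the same Bregman divergence.                                   *)
Definition continuously_differentiable_relint Q (phi : E -> R)
    (dphi : E -> {linear E -> R^o}) : Prop :=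
  (forall y, relint Q y ->
     forall e : R, 0 < e -> \forall x \near y, Q x ->
       `|phi x - phi y - dphi y (x - y)| <= e * `|x - y|) /\
  (forall v, {within relint Q, continuous (fun y => dphi y v : R^o)}).

Definition bregman (phi : E -> R) (dphi : E -> {linear E -> R^o}) y x : R :=
  phi x - phi y - dphi y (x - y).

(* [fy] and [psi] are the value f_delta(y) and the function psi_delta.         *)
(* D_phi[z](x) is defined only for z in the relative interior of Q, so the     *)
(* last condition is required at these points z.                               *)
Definition is_model Q phi dphi (f : E -> R) (delta L mu m : R) y
    (fy : R) (psi : E -> E -> R) : Prop :=
  [/\ forall x, Q x ->
        mu * bregman phi dphi y x <= f x - (fy + psi x y) /\
        f x - (fy + psi x y) <= L * bregman phi dphi y x + delta,
      convex_function Q (psi^~ y),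
      forall x, Q x -> psi x x = 0
    & forall x z, Q x -> relint Q z ->
        forall g, subdifferential Q (psi^~ y) z g ->
          psi z y + g (x - z) + m * bregman phi dphi z x <= psi x y].

(* [inexact_argmin Q d Psi u]: u is an admissible value of argmin^d_{Q} Psi.   *)
Definition inexact_argmin Q (d : R) (Psi : E -> R) (u : E) : Prop :=
  Q u /\ exists2 h, subdifferential Q Psi u h &
           forall x, Q x -> - d <= h (x - u).

End ConvexAnalysis.

Definition largest_root (R : realType) (p q : R -> R) (a : R) : Prop :=
  p a = q a /\ forall b, p b = q b -> b <= a.

(* The quantities (M_k, alpha_k, A_k, y_k, u_k, x_k) of iteration k. *)
Record iterate (R : realType) (E : normedModType R) := Iterate {
  itM : R; italpha : R; itA : R; ity : E; itu : E; itx : E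
}.

Section Algorithm.
Context {R : realType} {E : normedModType R}.
Variables (Q : set E) (phi : E -> R) (dphi : E -> {linear E -> R^o}).
Variables (fd : R -> E -> R) (psi : R -> E -> E -> R) (mu m : R).
Implicit Types (s t : iterate E).

Local Notation D := (bregman phi dphi).

Definition Phi (d : R) s (alpha : R) (y x : E) : R :=
  alpha * psi d x y + (1 + itA s * (mu + m)) * D (itu s) x
  + alpha * mu * D y x.

(* [trial d td s i t]: t is a candidate for the iterate following s, computed  *)
(* with the exponent i in the search for M_{k+1}. This is a relation because   *)
(* the inexact projection may return any admissible point.                     *)
Definition trial (d td : R) s (i : nat) t : Prop :=
  [/\ itM t = 2 ^ (i%:Z - 1) * itM s,
      largest_root (fun a => (itA s + a) * (1 + itA s * mu + itA s * m))
                   (fun a => itM t * a ^+ 2) (italpha t)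
        /\ itA t = itA s + italpha t,
      ity t = (itA t)^-1 *: (italpha t *: itu s + itA s *: itx s),
      inexact_argmin Q td (Phi d s (italpha t) (ity t)) (itu t)
    & itx t = (itA t)^-1 *: (italpha t *: itu t + itA s *: itx s)].

Definition accepted (d : R) s t : Prop :=
  fd d (itx t) <= fd d (ity t) + psi d (itx t) (ity t)
    + itM t * italpha t ^+ 2 / itA t ^+ 2 * D (itu s) (itu t) + d.

(* The search stops at the smallest accepted exponent: the candidates computed *)
(* for the smaller exponents were all rejected.                                *)
Definition agm_step (d td : R) s t : Prop :=
  exists i : nat,
    [/\ trial d td s i t, accepted d s t
      & forall j : nat, (j < i)%N ->
          exists2 t', trial d td s j t' & ~ accepted d s t'].

Definition agm_run (delta tdelta : nat -> R) (x0 : E) (M0 : R) (N : nat)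
    (s : nat -> iterate E) : Prop :=
  s 0%N = Iterate M0 0 0 x0 x0 x0 /\
  forall k, (k < N)%N -> agm_step (delta k) (tdelta k) (s k) (s k.+1).

End Algorithm.

(* Main.v *)
Require Import Defs.
From mathcomp Require Import all_boot all_order all_algebra.
From mathcomp Require Import all_classical all_reals all_analysis.
From mathcomp Require Import ring lra.

Set Implicit Arguments.
Unset Strict Implicit.
Unset Printing Implicit Defensive.

Import Order.TTheory GRing.Theory Num.Theory.
Import numFieldNormedType.Exports.

Local Open Scope classical_set_scope.
Local Open Scope ring_scope.

(** The proof tracks the potential
    [V k = A_k (f x_k - f xstar) + (1 + A_k mu + A_k m) D u_k xstar],
    with [D] the Bregman divergence. One iteration raises [V] by at most
    [2 A_(k+1) delta_k + tdelta_k] ([agm_step_potential]); since [V 0] is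
    [D u_0 xstar], summing bounds [V N], and both summands of [V N] are
    nonnegative, so each of them is bounded separately. Dividing by [A_N],
    respectively by [1 + A_N mu + A_N m], gives the two estimates.

    The analytic content is in the inexact projection step. The subgradient
    that certifies the projection belongs to the whole subproblem (model plus
    Bregman terms), while relative strong convexity of the model needs a
    subgradient of the model alone. Such a subgradient is obtained by
    subtracting the gradient of the smooth part
    ([subdifferential_smooth_sum]): comparing values along a segment issued
    from the point, the convex part is at most linear in the step and the smooth
    part is linear up to a little-o, so dividing by the step isolates the
    convex part. The same argument with the convex function [phi] itself and
    smooth part [- phi] yields nonnegativity of the Bregman divergence. *)

(** * Convexity along segments *)

Section ConvexOnSegments.
Context {R : realType} {E : normedModType R}.
Implicit Types (Q : set E) (x z d : E) (t : R).

Lemma segmentE x z t : t *: x + (1 - t) *: z = z + t *: (x - z).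
Proof.
by rewrite scalerBl scale1r scalerBr addrCA.
Qed.

Lemma convex_set_segment Q x z t : convex_set Q -> Q x -> Q z ->
  0 <= t -> t <= 1 -> Q (z + t *: (x - z)).
Proof.
move=> cQ Qx Qz t0 t1; have t01 : 0 <= t <= 1 by rewrite t0.
have := cQ x z (Itv01 t0 t1) (mem_set Qx) (mem_set Qz).
by move/set_mem; rewrite -segmentE.
Qed.

Lemma convex_function_segment Q (g : E -> R) x z t : convex_function Q g ->
  Q x -> Q z -> 0 <= t -> t <= 1 ->
  g (z + t *: (x - z)) <= g z + t * (g x - g z).
Proof.
move=> cg Qx Qz t0 t1.
have := cg (Itv01 t0 t1) x z (mem_set Qx) (mem_set Qz).
rewrite -segmentE convRE /= => /le_trans; apply.
by rewrite mulrBl mul1r mulrBr addrCA.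
Qed.

End ConvexOnSegments.

(** * Subgradients of convex-plus-smooth functions *)

Section SmoothPart.
Context {R : realType} {E : normedModType R}.
Variables (Q : set E) (phi : E -> R) (dphi : E -> {linear E -> R^o}).
Hypothesis convQ : convex_set Q.
Hypothesis C1_phi : continuously_differentiable_relint Q phi dphi.

Local Notation D := (bregman phi dphi).

(** Differentiability of [phi] at [z], read along the segment towards [x]. A
    single step [t] for each [e] suffices: an inequality between convex and
    linear terms at that step scales back to [x] with error [e]. *)
Lemma bregman_littleo z x (e : R) : relint Q z -> Q x -> 0 < e ->
  exists t : R, [/\ 0 < t, t <= 1 & `|D z (z + t *: (x - z))| <= t * e].
Proof.
move=> rz Qx e0; have Qz : Q z by case: rz.
set d := x - z; have d1 : 0 < `|d| + 1 by rewrite ltr_wpDl.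
have e1 : 0 < e / (`|d| + 1) by rewrite divr_gt0.
have [r /= r0 Hr] := (nbhs_normP _ _).1 (C1_phi.1 z rz _ e1).
(* The step is small enough to stay in the ball where the expansion holds. *)
set t := Num.min 1 (r / (`|d| + 1)).
have t0 : 0 < t by rewrite lt_min ltr01 divr_gt0.
have t1 : t <= 1 by rewrite ge_min lexx.
have tr : t * (`|d| + 1) <= r by rewrite -ler_pdivlMr// ge_min lexx orbT.
exists t; split=> //.
have zd : z + t *: d - z = t *: d by rewrite addrC addKr.
have := Hr (z + t *: d); rewrite /bregman /= zd => Hw; apply: le_trans (Hw _ _) _.
- rewrite opprD addrA subrr add0r normrN normrZ (gtr0_norm t0).
  by apply: lt_le_trans tr; rewrite ltr_pM2l// ltrDl.
- exact: convex_set_segment (ltW t0) t1.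
rewrite normrZ (gtr0_norm t0) mulrCA ler_pM2l// mulrAC ler_pdivrMr//.
by rewrite ler_pM2l// lerDl.
Qed.

(** A subgradient [h] of [a * psi + c * phi] at [z] becomes one of [psi] after
    removing the gradient of [c * phi]. The sign of [c] is free because [phi]
    enters only through its first-order expansion at [z]. *)
Lemma subdifferential_smooth_sum (psi : E -> R) (a c : R) z
    (h : {linear E -> R^o}) : convex_function Q psi -> 0 < a -> relint Q z ->
  (forall x, Q x -> a * psi z + c * phi z + h (x - z) <= a * psi x + c * phi x) ->
  subdifferential Q psi z (a^-1 \*: (h \- c \*: dphi z)).
Proof.
move=> cpsi a0 rz H; have Qz : Q z by case: rz.
split=> // x Qx; rewrite addrC -lerBrDr /= /GRing.scale /=.
rewrite mulrC ler_pdivrMr//; apply/ler_addgt0Pr => e e0.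
have c1 : 0 < `|c| + 1 by rewrite ltr_wpDl.
have [t [t0 t1 Dt]] := bregman_littleo rz Qx (divr_gt0 e0 c1).
set w := z + t *: (x - z).
have Qw : Q w by apply: convex_set_segment => //; exact: ltW.
have zw : w - z = t *: (x - z) by rewrite /w addrC addKr.
have := H _ Qw; rewrite zw linearZ /= => Hw.
have psiw := convex_function_segment cpsi Qx Qz (ltW t0) t1.
move: Dt; rewrite /bregman -/w zw linearZ /= => Dt.
have cD : c * (phi w - phi z - t * dphi z (x - z)) <= t * e.
  apply: le_trans (ler_norm _) _; rewrite normrM.
  apply: (@le_trans _ _ (`|c| * (t * (e / (`|c| + 1))))).
    by rewrite ler_wpM2l.
  rewrite mulrCA ler_pM2l// mulrA ler_pdivrMr//.
  by rewrite mulrC ler_pM2l// lerDl.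
rewrite -(ler_pM2l t0).
have apsi : a * psi w <= a * (psi z + t * (psi x - psi z)) by rewrite ler_pM2l.
move: Hw apsi cD; rewrite /GRing.scale /=; nra.
Qed.

(** The zero form is a subgradient of [phi - phi], hence [dphi z] is one of
    [phi]. *)
Lemma bregman_ge0 z x : convex_function Q phi -> relint Q z -> Q x -> 0 <= D z x.
Proof.
move=> cphi rz Qx.
have H w : Q w -> 1 * phi z + (-1) * phi z + (\0%R : {linear E -> R^o}) (w - z)
    <= 1 * phi w + (-1) * phi w.
  by move=> _; rewrite !mulN1r !mul1r !subrr add0r.
have [_ /(_ x Qx)] := subdifferential_smooth_sum cphi ltr01 rz H.
rewrite /= /GRing.scale /= /bregman invr1 mul1r mulN1r sub0r opprK.
by move=> ?; lra.
Qed.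

Lemma bregman_diag z : D z z = 0.
Proof. by rewrite /bregman !subrr linear0 subrr. Qed.

(** Inexact three-point inequality. The term [(b + c) * D v x] comes from the
    identity [D u x - D u v - D v x = dphi v (x - v) - dphi u (x - v)] and its
    analogue for [y]; the term [a * m * D v x] comes from the relative strong
    convexity of [psi]. *)
Lemma inexact_bregman_prox (psi : E -> R) (m a b c d : R) (u y v x : E) :
  convex_function Q psi ->
  (forall x z, Q x -> relint Q z -> forall g, subdifferential Q psi z g ->
     psi z + g (x - z) + m * D z x <= psi x) ->
  0 < a -> relint Q v -> Q x ->
  inexact_argmin Q d (fun z => a * psi z + b * D u z + c * D y z) v ->
  a * psi v + b * D u v + c * D y v + (b + c + a * m) * D v x
  <= a * psi x + b * D u x + c * D y x + d.
Proof.
move=> cpsi spsi a0 rv Qx [Qv [h [_ hsub] hd]].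
have shift (w z : E) (l : {linear E -> R^o}) :
    l (w - z) = (l w : R) - (l z : R) by rewrite linearB.
(* The divergences are [phi] plus affine functions, whose linear parts are
   moved into the subgradient. *)
have H w : Q w ->
    a * psi v + (b + c) * phi v + (h \+ (b \*: dphi u \+ c \*: dphi y)) (w - v)
    <= a * psi w + (b + c) * phi w.
  move=> Qw; have := hsub w Qw.
  have -> : (h \+ (b \*: dphi u \+ c \*: dphi y)) (w - v)
      = (h (w - v) : R) + (b * dphi u (w - v) + c * dphi y (w - v)) by [].
  rewrite /bregman !shift; lra.
have strong : psi v + a^-1 * ((h (x - v) : R)
      + (b * dphi u (x - v) + c * dphi y (x - v)) - (b + c) * dphi v (x - v))
    + m * D v x <= psi x.
  exact: spsi x v Qx rv _ (subdifferential_smooth_sum cpsi a0 rv H).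
move: strong; rewrite -(ler_pM2l a0) 2!mulrDr mulVKf ?gt_eqF//.
have := hd x Qx.
rewrite /bregman !shift; lra.
Qed.

End SmoothPart.

(** * Progress of one accelerated iteration *)

Section AcceleratedStep.
Context {R : realType} {E : normedModType R}.
Variables (Q : set E) (phi : E -> R) (dphi : E -> {linear E -> R^o}).
Hypothesis convQ : convex_set Q.
Hypothesis conv_phi : convex_function Q phi.
Hypothesis C1_phi : continuously_differentiable_relint Q phi dphi.
Variables (fd : R -> E -> R) (psi : R -> E -> E -> R) (mu m : R).
Hypotheses (mu_ge0 : 0 <= mu) (m_ge0 : 0 <= m).
Implicit Types (s t : iterate E).

Local Notation D := (bregman phi dphi).

(** The equation for the new weight increment is
    [M X^2 - B X - A B = 0] with [M > 0], [B > 0] and [A >= 0]; the largest root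
    dominates the explicit root [(B + sqrt (B^2 + 4 M A B)) / (2 M)], which is
    positive. *)
Lemma trial_gt0 d td s i t : 0 < itM s -> 0 <= itA s ->
  trial Q phi dphi psi mu m d td s i t -> 0 < itM t /\ 0 < italpha t.
Proof.
move=> M0 A0 [Mt [[_ large] _] _ _ _].
have Mt0 : 0 < itM t by rewrite Mt mulr_gt0// exprz_gt0.
split=> //; set M := itM t in Mt0 *; set A := itA s in A0 large *.
set B := 1 + A * mu + A * m in large.
have B0 : 0 < B by rewrite /B -addrA ltr_pwDl// addr_ge0// mulr_ge0.
set r := Num.sqrt (B ^+ 2 + 4 * M * A * B).
have disc0 : 0 <= B ^+ 2 + 4 * M * A * B.
  by rewrite addr_ge0 ?sqr_ge0// !mulr_ge0// ltW.
have r2 : r ^+ 2 = B ^+ 2 + 4 * M * A * B by rewrite sqr_sqrtr.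
apply: (@lt_le_trans _ _ ((B + r) / (2 * M))).
  by rewrite divr_gt0 ?mulr_gt0// ltr_wpDr// sqrtr_ge0.
apply: large; rewrite -/M.
have -> : M * ((B + r) / (2 * M)) ^+ 2 = (B ^+ 2 + 2 * B * r + r ^+ 2) / (4 * M).
  by field; rewrite gt_eqF.
by rewrite r2; field; rewrite gt_eqF.
Qed.

Lemma agm_step_gt0 d td s t : 0 < itM s -> 0 <= itA s ->
  agm_step Q phi dphi fd psi mu m d td s t -> 0 < itM t /\ 0 < itA t.
Proof.
move=> M0 A0 [i [tr _ _]]; have [M'0 a0] := trial_gt0 M0 A0 tr.
by split=> //; case: tr => _ [_ ->] _ _ _; rewrite ltr_wpDl.
Qed.

(** Why a weighted gap and a weighted distance decrease together: acceptance
    bounds [f] at the new point by the model there plus the term in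
    [D (itu s) (itu t)], and the equation defining the new weight makes the
    coefficient of that term exactly [1 + itA s * (mu + m)] after
    multiplication by [itA t]. By convexity the model at the new point splits
    into its values at [itx s] and [itu t]. The former lies below
    [f (itx s)]; the latter, together with the distance term, is compared with
    [xs] by [inexact_bregman_prox], where the lower model bound at [xs] absorbs
    the term [mu * D (ity t) xs]. The error [d] counts twice: once for
    acceptance, once for replacing the model value at [itx t] by [f]. *)
Lemma agm_step_potential (f : E -> R) (L d td : R) s t xs :
  is_model Q phi dphi f d L mu m (ity t) (fd d (ity t)) (psi d) ->
  is_model Q phi dphi f d L mu m (itx t) (fd d (itx t)) (psi d) ->
  0 < itM s -> 0 <= itA s -> Q xs ->
  relint Q (itu s) -> Q (itx s) ->
  relint Q (ity t) -> relint Q (itu t) -> relint Q (itx t) ->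
  agm_step Q phi dphi fd psi mu m d td s t ->
  itA t * (f (itx t) - f xs)
    + (1 + itA t * mu + itA t * m) * D (itu t) xs
  <= itA s * (f (itx s) - f xs)
    + (1 + itA s * mu + itA s * m) * D (itu s) xs
    + (2 * (itA t * d) + td).
Proof.
move=> [my cpsi _ spsi] [mx _ psixx _] M0 A0 Qxs ru Qx ry ru' rx' [i [tr acc _]].
have [_ a0] := trial_gt0 M0 A0 tr.
case: tr => _ [[root _] At] _ argmin xt.
have Qu' : Q (itu t) by case: ru'.
have Qx' : Q (itx t) by case: rx'.
have As : itA s = itA t - italpha t by rewrite At addrK.
have A'0 : 0 < itA t by rewrite At ltr_wpDl.
have fx' : f (itx t) <= fd d (itx t) + d.
  by have [_] := mx _ Qx'; rewrite bregman_diag psixx//; lra.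
have coef : itA t * (itM t * italpha t ^+ 2 / itA t ^+ 2)
    = 1 + itA s * mu + itA s * m.
  by rewrite -root -At; field; rewrite gt_eqF.
have psix' : itA t * psi d (itx t) (ity t)
    <= itA s * psi d (itx s) (ity t) + italpha t * psi d (itu t) (ity t).
  have -> : itx t = itx s + (italpha t / itA t) *: (itu t - itx s).
    rewrite xt -segmentE scalerDr !scalerA ![_^-1 * _]mulrC; congr (_ + _ *: _).
    by rewrite As; field; rewrite gt_eqF.
  have := @convex_function_segment _ _ Q (psi d ^~ (ity t)) (itu t) (itx s)
    (italpha t / itA t) cpsi Qu' Qx.
  move=> /(_ (divr_ge0 (ltW a0) (ltW A'0))).
  rewrite ler_pdivrMr// mul1r {1}At lerDr => /(_ A0).
  rewrite -(ler_pM2l A'0) => /le_trans; apply.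
  rewrite mulrDr (mulrCA _ (italpha t / _)) (mulrA (italpha t / _)).
  by rewrite divfK ?gt_eqF// As; lra.
(* The coefficient [1 + itA s * (mu + m) + italpha t * mu + italpha t * m] of
   [D (itu t) xs] below is [1 + itA t * (mu + m)]. *)
have prox := inexact_bregman_prox convQ C1_phi cpsi spsi a0 ru' Qxs argmin.
have [fxs _] := my _ Qxs.
have [fxk _] := my _ Qx.
have Dyx : 0 <= mu * D (ity t) (itx s).
  by rewrite mulr_ge0//; exact: bregman_ge0 C1_phi _ _ _ _ _.
have Dyu : 0 <= mu * D (ity t) (itu t).
  by rewrite mulr_ge0//; exact: bregman_ge0 C1_phi _ _ _ _ _.
have {}Dyu := mulr_ge0 (ltW a0) Dyu.
have fxkA : itA s * (fd d (ity t) + psi d (itx s) (ity t)) <= itA s * f (itx s).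
  by rewrite ler_wpM2l//; lra.
have fxsA : italpha t * (fd d (ity t) + psi d xs (ity t) + mu * D (ity t) xs)
    <= italpha t * f xs.
  by rewrite ler_pM2l//; lra.
have descent : itA t * f (itx t) <= itA t * fd d (ity t)
    + (itA s * psi d (itx s) (ity t) + italpha t * psi d (itu t) (ity t))
    + (1 + itA s * mu + itA s * m) * D (itu s) (itu t) + 2 * (itA t * d).
  have : itA t * f (itx t) <= itA t * (fd d (ity t) + psi d (itx t) (ity t)
      + itM t * italpha t ^+ 2 / itA t ^+ 2 * D (itu s) (itu t) + d + d).
    by rewrite ler_pM2l//; apply: le_trans fx' _; rewrite lerD2r.
  have := congr1 ( *%R^~ (D (itu s) (itu t))) coef; rewrite /= -mulrA.
  by set c := (itM t * _ / _); lra.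
move: descent prox; rewrite !At; lra.
Qed.

End AcceleratedStep.
(** * Convergence rates *)

Theorem theorem2p6 (R : realType) (E : normedModType R)
    (finE : finite_dimensional E)
    (Q : set E) (convQ : convex_set Q)
    (phi : E -> R) (dphi : E -> {linear E -> R^o})
    (conv_phi : convex_function Q phi)
    (C1_phi : continuously_differentiable_relint Q phi dphi)
    (f : E -> R) (xstar : E)
    (Qxstar : Q xstar) (min_xstar : forall x, Q x -> f xstar <= f x)
    (L mu m : R) (L_ge0 : 0 <= L) (mu_ge0 : 0 <= mu) (m_ge0 : 0 <= m)
    (delta tdelta : nat -> R)
    (delta_ge0 : forall k, 0 <= delta k) (tdelta_ge0 : forall k, 0 <= tdelta k)
    (fd : R -> E -> R) (psi : R -> E -> E -> R)
    (model : forall (k : nat) (y : E), relint Q y ->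
       is_model Q phi dphi f (delta k) L mu m y (fd (delta k) y) (psi (delta k)))
    (G : R) (G_ge1 : 1 <= G)
    (scaling : forall (x y u u' : E) (tau : R),
       relint Q x -> relint Q y -> relint Q u -> relint Q u' ->
       0 <= tau -> tau <= 1 -> x - y = tau *: (u' - u) ->
       bregman phi dphi y x <= G * tau ^+ 2 * bregman phi dphi u u')
    (x0 : E) (M0 : R) (Qx0 : Q x0) (M0_gt0 : 0 < M0)
    (N : nat) (N_ge1 : (1 <= N)%N)
    (s : nat -> iterate E)
    (run : agm_run Q phi dphi fd psi mu m delta tdelta x0 M0 N s)
    (points_relint : forall k, (k <= N)%N ->
       [/\ relint Q (ity (s k)), relint Q (itu (s k)) & relint Q (itx (s k))]) :
  f (itx (s N)) - f xstar <=
    bregman phi dphi (itu (s 0%N)) xstar / itA (s N)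
    + 2 * (\sum_(0 <= k < N) itA (s k.+1) * delta k) / itA (s N)
    + (\sum_(0 <= k < N) tdelta k) / itA (s N)
  /\
  bregman phi dphi (itu (s N)) xstar <=
    bregman phi dphi (itu (s 0%N)) xstar
      / (1 + itA (s N) * mu + itA (s N) * m)
    + 2 * (\sum_(0 <= k < N) itA (s k.+1) * delta k)
      / (1 + itA (s N) * mu + itA (s N) * m)
    + (\sum_(0 <= k < N) tdelta k)
      / (1 + itA (s N) * mu + itA (s N) * m).
Proof.
have inv k : (k <= N)%N -> 0 < itM (s k) /\ 0 <= itA (s k).
  elim: k => [_|k IH kN]; first by rewrite run.1.
  have [M0k A0k] := IH (ltnW kN).
  by have [Mk /ltW Ak] := agm_step_gt0 mu_ge0 m_ge0 M0k A0k (run.2 k kN).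
pose V k := itA (s k) * (f (itx (s k)) - f xstar)
  + (1 + itA (s k) * mu + itA (s k) * m) * bregman phi dphi (itu (s k)) xstar.
have step k : (k < N)%N ->
    V k.+1 - V k <= 2 * (itA (s k.+1) * delta k) + tdelta k.
  move=> kN; have [M0k A0k] := inv k (ltnW kN).
  have [_ ru [Qx _]] := points_relint _ (ltnW kN).
  have [ry ru' rx'] := points_relint _ kN.
  rewrite lerBlDl.
  exact: (agm_step_potential convQ conv_phi C1_phi mu_ge0 m_ge0
    (model k _ ry) (model k _ rx') M0k A0k Qxstar ru Qx ry ru' rx' (run.2 k kN)).
have A_gt0 : 0 < itA (s N).
  have lastN : (N.-1 < N)%N by rewrite prednK.
  have [Mlast Alast] := inv N.-1 (ltnW lastN).
  have := agm_step_gt0 mu_ge0 m_ge0 Mlast Alast (run.2 N.-1 lastN).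
  by rewrite prednK// => -[].
have [_ ruN [QxN _]] := points_relint _ (leqnn N).
have fN := min_xstar _ QxN.
have DN := bregman_ge0 convQ C1_phi conv_phi ruN Qxstar.
have B_gt0 : 0 < 1 + itA (s N) * mu + itA (s N) * m.
  by rewrite -addrA ltr_pwDl// addr_ge0// mulr_ge0// ltW.
have V0 : V 0%N = bregman phi dphi (itu (s 0%N)) xstar.
  by rewrite /V run.1 /= !mul0r !addr0 add0r mul1r.
have VN : V N <= V 0%N + 2 * (\sum_(0 <= k < N) itA (s k.+1) * delta k)
    + \sum_(0 <= k < N) tdelta k.
  rewrite -addrA -lerBlDl -(telescope_sumr V (leq0n N)) mulr_sumr -big_split /=.
  by rewrite !big_nat; apply: ler_sum => k /andP[_]; exact: step.
split; rewrite -!mulrDl -V0 ler_pdivlMr// mulrC; apply: le_trans VN; rewrite /V.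
- by rewrite lerDl mulr_ge0// ltW.
- by rewrite lerDr mulr_ge0 ?subr_ge0// ltW.
Qed.
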